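(* Let $H$ be a separable infinite dimensional complex Hilbert space and let $L(H)$ be the C*-algebra of bounded linear operators on $H$. There is a nonprincipal ultrafilter $\mathcal{V}$ on $\mathbb{N}$ such that $F_{\mathcal{V}}(L(H)) \neq \mathbb{C}$.
   Context: For a C*-algebra $A$ and an ultrafilter $\mathcal{V}$ on $\mathbb{N} = \{0,1,2,\dots\}$, let $\ell^\infty(A)$ be the C*-algebra of all norm-bounded sequences in $A$, let $c_{\mathcal{V}}(A) = \{(a_n) \in \ell^\infty(A) : \lim_{n\to\mathcal{V}} \|a_n\| = 0\}$ (a norm-closed two-sided ideal), and let $A^{\mathcal{V}} = \ell^\infty(A)/c_{\mathcal{V}}(A)$ be the (norm) ultrapower. $A$ is identified with the image in $A^{\mathcal{V}}$ of the constant sequences. For $A \subseteq B$, $A' \cap B = \{b \in B : ab = ba \text{ for all } a \in A\}$. $F_{\mathcal{V}}(A)$ is the quotient of $A' \cap A^{\mathcal{V}}$ by the annihilator $\{b \in A^{\mathcal{V}} : ba = 0 \text{ for all } a \in A\}$; if $A$ is unital the annihilator is trivial and $F_{\mathcal{V}}(A) = A' \cap A^{\mathcal{V}}$. The symbol $\mathbb{C}$ in ''$F_{\mathcal{V}}(L(H)) = \mathbb{C}$'' denotes the scalar multiples of the identity. *)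

(* Defs.v *)
From HB Require Import structures.
From mathcomp Require Import all_boot all_order all_algebra.
From mathcomp Require Import generic_quotient ring_quotient complex.
From mathcomp Require Import boolp classical_sets functions cardinality reals.
From mathcomp Require Import topology normedtype.

Set Implicit Arguments.
Unset Strict Implicit.
Unset Printing Implicit Defensive.

Import Order.TTheory GRing.Theory Num.Theory.
Import numFieldNormedType.Exports.

Local Open Scope classical_set_scope.
Local Open Scope ring_scope.
Local Open Scope quotient_scope.
Local Open Scope complex_scope.

(* In MathComp-Analysis the norm of a normed module over R[i] takes its values
   in R[i]; [rnorm] is the same norm, with values in R. *)
Definition rnorm (R : realType) (V : normedZmodType R[i]) (x : V) : R :=
  complex.Re `|x|.

Section Rnorm.
Variables (R : realType) (V : normedZmodType R[i]).
Implicit Types (x y : V) (k l : R[i]).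

Lemma rnormE x : `|x| = (rnorm x)%:C.
Proof. by rewrite /rnorm RRe_real// normr_real. Qed.

Lemma rnorm_ge0 x : 0 <= rnorm x.
Proof. by rewrite -lecR -rnormE normr_ge0. Qed.

Lemma rnorm0 : rnorm (0 : V) = 0.
Proof. by rewrite /rnorm normr0. Qed.

Lemma rnorm_eq0 x : (rnorm x == 0) = (x == 0).
Proof. by rewrite -(inj_eq (@complexI R)) -rnormE normr_eq0. Qed.

Lemma rnormD x y : rnorm (x + y) <= rnorm x + rnorm y.
Proof. by rewrite -lecR rmorphD/= -!rnormE ler_normD. Qed.

End Rnorm.

Lemma rnormZ (R : realType) (V : normedModType R[i]) (k : R[i]) (x : V) :
  rnorm (k *: x) = rnorm k * rnorm x.
Proof. by apply: complexI; rewrite rmorphM/= -!rnormE normrZ. Qed.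

(* Only the norm and the unital algebra structure enter the definitions of the
   norm ultrapower and of its relative commutants; the involution of a
   C*-algebra plays no role in them. The norm is a separate operation [anorm]
   since MathComp has no structure combining its generic norm with a
   non-commutative product. *)
HB.mixin Record isNormedAlgebra (R : realType) A of GRing.Algebra R[i] A := {
  anorm : A -> R;
  anormD : forall a b : A, anorm (a + b) <= anorm a + anorm b;
  anormZ : forall (k : R[i]) (a : A), anorm (k *: a) = rnorm k * anorm a;
  anorm0_eq0 : forall a : A, anorm a = 0 -> a = 0;
  anormM : forall a b : A, anorm (a * b) <= anorm a * anorm b
}.

#[short(type="normedAlgType")]
HB.structure Definition NormedAlgebra (R : realType) :=
  {A of GRing.Algebra R[i] A & isNormedAlgebra R A}.

Section NormedAlgebraTheory.
Variables (R : realType) (A : normedAlgType R).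
Implicit Types a b : A.

Lemma anorm0 : anorm (0 : A) = 0.
Proof. by rewrite -(scale0r (0 : A)) anormZ rnorm0 mul0r. Qed.

Lemma anormN a : anorm (- a) = anorm a.
Proof. by rewrite -scaleN1r anormZ /rnorm normrN1 mul1r. Qed.

Lemma anorm_ge0 a : 0 <= anorm a.
Proof.
rewrite -(@pmulr_rge0 _ 2)// mulr_natl mulr2n -{2}(anormN a) -anorm0.
by rewrite -(subrr a) anormD.
Qed.

Lemma anormB a b : anorm (a - b) <= anorm a + anorm b.
Proof. by rewrite -(anormN b) anormD. Qed.

End NormedAlgebraTheory.

HB.mixin Record isTwoSidedIdeal (A : nzRingType) (I : {pred A}) := {
  ideal_proper : 1 \notin I;
  ideal_mull : forall a x, x \in I -> a * x \in I;
  ideal_mulr : forall a x, x \in I -> x * a \in I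
}.

#[short(type="twoSidedIdeal")]
HB.structure Definition TwoSidedIdeal (A : nzRingType) :=
  {I of GRing.ZmodClosed A I & isTwoSidedIdeal A I}.

(* The type is a fresh alias of the library's quotient by an additive
   subgroup, whose ring structure is only available over commutative rings. *)
Definition quot_alg (A : nzRingType) (I : twoSidedIdeal A) : Type :=
  Quotient.quot I.

HB.instance Definition _ (A : nzRingType) (I : twoSidedIdeal A) :=
  GRing.Zmodule.copy (quot_alg I) (Quotient.quot I).

Definition quot_pi (A : nzRingType) (I : twoSidedIdeal A) (a : A) : quot_alg I :=
  \pi_(Quotient.quot I) a.

Section QuotAlg.
Variables (K : pzRingType) (A : algType K) (I : twoSidedIdeal A).
Local Notation Q := (quot_alg I).
Local Notation pi := (@quot_pi A I).

Lemma quot_piP (a b : A) : pi a = pi b <-> a - b \in I.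
Proof. by rewrite Quotient.idealrBE; split=> [e|/eqP//]; exact/eqP. Qed.

Let rep (q : Q) : A := repr (q : Quotient.quot I).

Let repK q : pi (rep q) = q. Proof. exact: reprK. Qed.

Let rep_pi a : rep (pi a) - a \in I.
Proof. by apply/quot_piP; rewrite repK. Qed.

Lemma quot_pi_surj (q : Q) : exists a, q = pi a.
Proof. by exists (rep q); rewrite repK. Qed.

Lemma quot_piD a b : pi (a + b) = pi a + pi b.
Proof. exact: (Quotient.pi_add I a b). Qed.

Lemma quot_pi0 : pi 0 = 0.
Proof. by apply: (@addrI _ (pi 0)); rewrite -quot_piD !addr0. Qed.

Definition quot_one : Q := pi 1.
Definition quot_mul (p q : Q) : Q := pi (rep p * rep q).
Definition quot_scale (k : K) (q : Q) : Q := pi (k *: rep q).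

Lemma quot_piM a b : pi (a * b) = quot_mul (pi a) (pi b).
Proof.
apply/esym/quot_piP; set a' := rep _; set b' := rep _.
have -> : a' * b' - a * b = (a' - a) * b' + a * (b' - b).
  by rewrite mulrBl mulrBr addrA subrK.
by apply: rpredD; [exact/ideal_mulr/rep_pi|exact/ideal_mull/rep_pi].
Qed.

Let idealZ k a : a \in I -> k *: a \in I.
Proof. by move=> aI; rewrite -[a]mul1r scalerAl ideal_mull. Qed.

Lemma quot_piZ k a : pi (k *: a) = quot_scale k (pi a).
Proof. by apply/esym/quot_piP; rewrite -scalerBr idealZ ?rep_pi. Qed.

Lemma quot_ind (P : Q -> Prop) : (forall a, P (pi a)) -> forall q, P q.
Proof. by move=> Ppi q; have [a ->] := quot_pi_surj q. Qed.

Let mulA : associative quot_mul.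
Proof.
elim/quot_ind=> a; elim/quot_ind=> b; elim/quot_ind=> c.
by rewrite -!quot_piM mulrA.
Qed.
Let mul1 : left_id quot_one quot_mul.
Proof. by elim/quot_ind=> a; rewrite -!quot_piM mul1r. Qed.
Let mulr1' : right_id quot_one quot_mul.
Proof. by elim/quot_ind=> a; rewrite -!quot_piM mulr1. Qed.
Let mulDl : left_distributive quot_mul +%R.
Proof.
elim/quot_ind=> a; elim/quot_ind=> b; elim/quot_ind=> c.
by rewrite -!(quot_piM, quot_piD) mulrDl.
Qed.
Let mulDr : right_distributive quot_mul +%R.
Proof.
elim/quot_ind=> a; elim/quot_ind=> b; elim/quot_ind=> c.
by rewrite -!(quot_piM, quot_piD) mulrDr.
Qed.

Let one_neq0 : quot_one != 0.
Proof.
rewrite -quot_pi0; apply/eqP => /quot_piP; rewrite subr0.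
by apply/negP; exact: ideal_proper.
Qed.

HB.instance Definition _ := GRing.Zmodule_isNzRing.Build Q
  mulA mul1 mulr1' mulDl mulDr one_neq0.

Let scaleA k l q : quot_scale k (quot_scale l q) = quot_scale (k * l) q.
Proof. by elim/quot_ind: q => a; rewrite -!quot_piZ scalerA. Qed.
Let scale1 : left_id 1 quot_scale.
Proof. by elim/quot_ind=> a; rewrite -!quot_piZ scale1r. Qed.
Let scaleDr : right_distributive quot_scale +%R.
Proof.
move=> k; elim/quot_ind=> a; elim/quot_ind=> b.
by rewrite -!(quot_piD, quot_piZ) scalerDr.
Qed.
Let scaleDl q : {morph quot_scale^~ q : a b / a + b}.
Proof.
by move=> k l; elim/quot_ind: q => a; rewrite -!quot_piZ -quot_piD scalerDl.
Qed.

HB.instance Definition _ := GRing.Zmodule_isLmodule.Build K Q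
  scaleA scale1 scaleDr scaleDl.

Let scaleAl (k : K) (p q : Q) : k *: (p * q) = k *: p * q.
Proof.
elim/quot_ind: p => a; elim/quot_ind: q => b.
rewrite /GRing.scale/= /GRing.mul/=.
by rewrite -!(quot_piM, quot_piZ) scalerAl.
Qed.
Let scaleAr (k : K) (p q : Q) : k *: (p * q) = p * (k *: q).
Proof.
elim/quot_ind: p => a; elim/quot_ind: q => b.
rewrite /GRing.scale/= /GRing.mul/=.
by rewrite -!(quot_piM, quot_piZ) scalerAr.
Qed.

HB.instance Definition _ := GRing.Lmodule_isLalgebra.Build K Q scaleAl.
HB.instance Definition _ := GRing.Lalgebra_isAlgebra.Build K Q scaleAr.

End QuotAlg.

Section Linfty.
Variables (R : realType) (A : normedAlgType R).

Definition bounded_seq : {pred nat -> A} :=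
  [pred a | `[< exists M : R, forall n, anorm (a n) <= M >]].

Lemma bounded_seqP (a : nat -> A) :
  reflect (exists M : R, forall n, anorm (a n) <= M) (a \in bounded_seq).
Proof. exact: asboolP. Qed.

Let bounded_seq_subring : subring_closed bounded_seq.
Proof.
split=> [|a b /bounded_seqP[M aM] /bounded_seqP[N bN]
         |a b /bounded_seqP[M aM] /bounded_seqP[N bN]]; apply/bounded_seqP.
- by exists (anorm (1 : A)).
- by exists (M + N) => n; rewrite (le_trans (anormB _ _))// lerD.
- exists (M * N) => n; rewrite (le_trans (anormM _ _))//.
  by rewrite ler_pM ?anorm_ge0.
Qed.

HB.instance Definition _ :=
  GRing.isSubringClosed.Build (nat -> A) bounded_seq bounded_seq_subring.

Let bounded_seq_scaler : GRing.scaler_closed bounded_seq.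
Proof.
move=> k a /bounded_seqP[M aM]; apply/bounded_seqP.
by exists (rnorm k * M) => n; rewrite anormZ ler_wpM2l ?rnorm_ge0.
Qed.

HB.instance Definition _ :=
  GRing.isScaleClosed.Build R[i] (nat -> A) bounded_seq bounded_seq_scaler.

Record linfty := Linfty {linfty_seq :> nat -> A; _ : linfty_seq \in bounded_seq}.

HB.instance Definition _ := [isSub for linfty_seq].
HB.instance Definition _ := [Choice of linfty by <:].
HB.instance Definition _ := [SubChoice_isSubNzRing of linfty by <:].
HB.instance Definition _ := [SubZmodule_isSubLmodule of linfty by <:].

Let linfty_scalerAl (k : R[i]) (a b : linfty) : k *: (a * b) = k *: a * b.
Proof. by apply/val_inj/funext => n; exact: scalerAl. Qed.
Let linfty_scalerAr (k : R[i]) (a b : linfty) : k *: (a * b) = a * (k *: b).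
Proof. by apply/val_inj/funext => n; exact: scalerAr. Qed.
HB.instance Definition _ := GRing.Lmodule_isLalgebra.Build R[i] linfty
  linfty_scalerAl.
HB.instance Definition _ := GRing.Lalgebra_isAlgebra.Build R[i] linfty
  linfty_scalerAr.

Let cst_bounded (a : A) : (fun _ : nat => a) \in bounded_seq.
Proof. by apply/bounded_seqP; exists (anorm a). Qed.

Definition cst_linfty (a : A) : linfty := Linfty (cst_bounded a).

End Linfty.

Section Ultrapower.
Variables (R : realType) (V : pfilter_on nat) (A : normedAlgType R).

Definition c_ideal : {pred linfty A} :=
  [pred a : linfty A | `[< anorm (a n) @[n --> (V : set_system nat)] --> (0 : R) >]].

Lemma c_idealP (a : linfty A) :
  reflect (anorm (a n) @[n --> (V : set_system nat)] --> (0 : R)) (a \in c_ideal).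
Proof. exact: asboolP. Qed.

Let c_ideal_le (a : linfty A) (u : nat -> R) :
  (forall n, anorm (a n) <= u n) -> u n @[n --> (V : set_system nat)] --> (0 : R) ->
  a \in c_ideal.
Proof.
move=> au u0; apply/c_idealP.
apply: (squeeze_cvgr _ (cvg_cst 0) u0).
by apply: nearW => n /=; rewrite anorm_ge0 au.
Qed.

Let c_ideal_zmod : zmod_closed c_ideal.
Proof.
split=> [|a b /c_idealP a0 /c_idealP b0].
  apply: (@c_ideal_le _ (cst 0)) => [n|]; last exact: cvg_cst.
  by rewrite /= anorm0.
apply: (@c_ideal_le _ (fun n => anorm (a n) + anorm (b n))) => [n|].
  exact: anormB.
by rewrite -[X in _ --> X](addr0 (0 : R)); exact: cvgD.
Qed.

HB.instance Definition _ :=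
  GRing.isZmodClosed.Build (linfty A) c_ideal c_ideal_zmod.

Let c_ideal_proper : 1 \notin c_ideal.
Proof.
apply/negP => /c_idealP c1.
have : anorm (1 : A) = 0.
  by apply: (cvg_unique (@Rhausdorff R) _ c1); exact: cvg_cst.
by move/anorm0_eq0/eqP; rewrite oner_eq0.
Qed.

Let c_ideal_mull (a x : linfty A) : x \in c_ideal -> a * x \in c_ideal.
Proof.
have /bounded_seqP[M aM] := valP a.
move=> /c_idealP x0; apply: (@c_ideal_le _ (fun n => M * anorm (x n))) => [n|].
  by rewrite (le_trans (anormM _ _))// ler_wpM2r ?anorm_ge0 ?aM.
by rewrite -[X in _ --> X](mulr0 M); apply: cvgM => //; exact: cvg_cst.
Qed.

Let c_ideal_mulr (a x : linfty A) : x \in c_ideal -> x * a \in c_ideal.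
Proof.
have /bounded_seqP[M aM] := valP a.
move=> /c_idealP x0; apply: (@c_ideal_le _ (fun n => anorm (x n) * M)) => [n|].
  by rewrite (le_trans (anormM _ _))// ler_wpM2l ?anorm_ge0 ?aM.
by rewrite -[X in _ --> X](mul0r M); apply: cvgM => //; exact: cvg_cst.
Qed.

HB.instance Definition _ := isTwoSidedIdeal.Build (linfty A) c_ideal
  c_ideal_proper c_ideal_mull c_ideal_mulr.

Definition ultrapower := quot_alg [the twoSidedIdeal (linfty A) of c_ideal].
HB.instance Definition _ := GRing.Algebra.on ultrapower.

Definition diag (a : A) : ultrapower := quot_pi _ (cst_linfty a).

End Ultrapower.

Section Commutant.
Variables (K : pzRingType) (B : algType K) (S : set B).

Definition commutant_pred : {pred B} :=
  [pred b | `[< forall a, S a -> a * b = b * a >]].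

Lemma commutant_predP (b : B) :
  reflect (forall a, S a -> a * b = b * a) (b \in commutant_pred).
Proof. exact: asboolP. Qed.

Let commutant_subalg : subalg_closed commutant_pred.
Proof.
split=> [|k b c /commutant_predP bS /commutant_predP cS
         |b c /commutant_predP bS /commutant_predP cS];
  apply/commutant_predP => a Sa.
- by rewrite mulr1 mul1r.
- by rewrite mulrDr mulrDl -scalerAr -scalerAl bS// cS.
- by rewrite mulrA bS// -mulrA cS// mulrA.
Qed.

HB.instance Definition _ :=
  GRing.isSubalgClosed.Build K B commutant_pred commutant_subalg.

Record commutant := Commutant {
  commutant_val :> B; _ : commutant_val \in commutant_pred}.

HB.instance Definition _ := [isSub for commutant_val].
HB.instance Definition _ := [Choice of commutant by <:].
HB.instance Definition _ := [SubChoice_isSubAlgebra of commutant by <:].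

End Commutant.

Section FAlgebra.
Variables (R : realType) (V : pfilter_on nat) (A : normedAlgType R).

(* The relative commutant of A in its ultrapower. *)
Definition central_seq := commutant (range (@diag R V A)).
HB.instance Definition _ := GRing.Algebra.on central_seq.

(* The part of the annihilator of A lying in the relative commutant; as A is
   unital this is the whole annihilator, which is trivial. *)
Definition annihilator : {pred central_seq} :=
  [pred b : central_seq | `[< forall a : A, commutant_val b * diag V a = 0 >]].

Lemma annihilatorP (b : central_seq) :
  reflect (forall a : A, commutant_val b * diag V a = 0) (b \in annihilator).
Proof. exact: asboolP. Qed.

Let annihilator_zmod : zmod_closed annihilator.
Proof.
split=> [|b c /annihilatorP b0 /annihilatorP c0]; apply/annihilatorP => a.
  by rewrite mul0r.
by rewrite mulrBl b0 c0 subr0.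
Qed.

HB.instance Definition _ :=
  GRing.isZmodClosed.Build central_seq annihilator annihilator_zmod.

Lemma diag1 : diag V (1 : A) = 1.
Proof. by congr (quot_pi _ _); apply: val_inj. Qed.

Lemma annihilator_eq0 (b : central_seq) : (b \in annihilator) = (b == 0).
Proof.
apply/annihilatorP/eqP => [/(_ 1)|-> a]; last by rewrite mul0r.
by rewrite diag1 mulr1 => b0; exact: val_inj.
Qed.

Let annihilator_proper : 1 \notin annihilator.
Proof. by rewrite annihilator_eq0 oner_eq0. Qed.
Let annihilator_mull (b c : central_seq) :
  c \in annihilator -> b * c \in annihilator.
Proof. by rewrite !annihilator_eq0 => /eqP ->; rewrite mulr0. Qed.
Let annihilator_mulr (b c : central_seq) :
  c \in annihilator -> c * b \in annihilator.
Proof. by rewrite !annihilator_eq0 => /eqP ->; rewrite mul0r. Qed.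

HB.instance Definition _ := isTwoSidedIdeal.Build central_seq annihilator
  annihilator_proper annihilator_mull annihilator_mulr.

Definition F_alg := quot_alg [the twoSidedIdeal central_seq of annihilator].
HB.instance Definition _ := GRing.Algebra.on F_alg.

End FAlgebra.

Definition finite_dimensional (K : pzRingType) (U : lmodType K) : Prop :=
  exists (n : nat) (e : 'I_n -> U),
    forall x, exists c : 'I_n -> K, x = \sum_(i < n) c i *: e i.

Definition separable_space (T : topologicalType) : Prop :=
  exists S : set T, countable S /\ dense S.

HB.mixin Record isHilbert (R : realType) H of CompleteNormedModule R[i] H := {
  hdot : {dot H for Num.conj};
  hdot_norm : forall x : H, hdot x x = `|x| ^+ 2
}.

#[short(type="hilbertType")]
HB.structure Definition Hilbert (R : realType) :=
  {H of CompleteNormedModule R[i] H & isHilbert R H}.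

HB.mixin Record isInfiniteDimensional (R : realType) H of Hilbert R H := {
  infinite_dimensional : ~ finite_dimensional H
}.

(* Infinite dimension is part of the structure so that 1 != 0 in [boundedOp H],
   as MathComp requires of an algebra. *)
#[short(type="infHilbertType")]
HB.structure Definition InfHilbert (R : realType) :=
  {H of Hilbert R H & isInfiniteDimensional R H}.

Section BoundedOperators.
Variables (R : realType) (H : infHilbertType R).

Definition bounded_linear : {pred H -> H} :=
  [pred f | `[< linear f /\ exists M : R, forall x, rnorm (f x) <= M * rnorm x >]].

Lemma bounded_linearP (f : H -> H) :
  reflect (linear f /\ exists M : R, forall x, rnorm (f x) <= M * rnorm x)
    (f \in bounded_linear).
Proof. exact: asboolP. Qed.

Let bounded_linear_submod : submod_closed bounded_linear.
Proof.
split=> [|k f g /bounded_linearP[fl [M fM]] /bounded_linearP[gl [N gN]]];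
    apply/bounded_linearP; split.
- by move=> l x y; rewrite /= scaler0 addr0.
- by exists 0 => x; rewrite mul0r rnorm0.
- move=> l x y; rewrite /= !fctE fl gl !scalerDr !scalerA (mulrC k l).
  by rewrite !addrA; congr (_ + _); rewrite -!addrA; congr (_ + _); rewrite addrC.
- exists (rnorm k * M + N) => x; rewrite (le_trans (rnormD _ _))//.
  by rewrite mulrDl lerD// rnormZ -mulrA ler_wpM2l ?rnorm_ge0.
Qed.

HB.instance Definition _ :=
  GRing.isSubmodClosed.Build R[i] (H -> H) bounded_linear bounded_linear_submod.

Record boundedOp := BoundedOp {
  boundedOp_fun :> H -> H; _ : boundedOp_fun \in bounded_linear}.

HB.instance Definition _ := [isSub for boundedOp_fun].
HB.instance Definition _ := [Choice of boundedOp by <:].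
HB.instance Definition _ := [SubChoice_isSubLmodule of boundedOp by <:].

Lemma boundedOp_linear (f : boundedOp) : linear f.
Proof. by have /bounded_linearP[] := valP f. Qed.

Lemma boundedOp_bounded (f : boundedOp) :
  exists M : R, forall x, rnorm (f x) <= M * rnorm x.
Proof. by have /bounded_linearP[] := valP f. Qed.

Let id_bounded : id \in bounded_linear.
Proof. by apply/bounded_linearP; split=> //; exists 1 => x; rewrite mul1r. Qed.

Let comp_bounded (f g : boundedOp) : (f : H -> H) \o g \in bounded_linear.
Proof.
apply/bounded_linearP; split=> [k x y|].
  by rewrite /= !boundedOp_linear.
have [M fM] := boundedOp_bounded f; have [N gN] := boundedOp_bounded g.
exists (`|M| * N) => x; rewrite (le_trans (fM _))//.
rewrite (@le_trans _ _ (`|M| * rnorm (g x)))//.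
  by rewrite ler_wpM2r ?rnorm_ge0// ler_norm.
by rewrite -mulrA ler_wpM2l.
Qed.

Definition op_one : boundedOp := BoundedOp id_bounded.
Definition op_mul (f g : boundedOp) : boundedOp := BoundedOp (comp_bounded f g).

Let op_ext (f g : boundedOp) : (forall x, f x = g x) -> f = g.
Proof. by move=> fg; apply/val_inj/funext. Qed.

Let op_mulA : associative op_mul. Proof. by move=> f g h; exact: op_ext. Qed.
Let op_mul1 : left_id op_one op_mul. Proof. by move=> f; exact: op_ext. Qed.
Let op_mulr1 : right_id op_one op_mul. Proof. by move=> f; exact: op_ext. Qed.
Let op_mulDl : left_distributive op_mul +%R.
Proof. by move=> f g h; exact: op_ext. Qed.
Let op_mulDr : right_distributive op_mul +%R.
Proof.
move=> f g h; apply: op_ext => x /=.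
by have := boundedOp_linear f 1 (g x) (h x); rewrite !scale1r.
Qed.

Let op_one_neq0 : op_one != 0.
Proof.
apply/eqP => one0; apply: (@infinite_dimensional R H).
exists 0%N, (fun _ => 0) => x; exists (fun _ => 0); rewrite big_ord0.
exact: (congr1 (fun f : boundedOp => f x) one0).
Qed.

HB.instance Definition _ := GRing.Zmodule_isNzRing.Build boundedOp
  op_mulA op_mul1 op_mulr1 op_mulDl op_mulDr op_one_neq0.

Let op_scalerAl (k : R[i]) (f g : boundedOp) : k *: (f * g) = k *: f * g.
Proof. exact: op_ext. Qed.
Let op_scalerAr (k : R[i]) (f g : boundedOp) : k *: (f * g) = f * (k *: g).
Proof.
apply: op_ext => x; have f0 : f 0 = 0.
  have := boundedOp_linear f 1 0 0; rewrite !scale1r addr0.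
  by move/eqP; rewrite -subr_eq0 opprD addrA subrr sub0r oppr_eq0 => /eqP.
have := boundedOp_linear f k (g x) 0; rewrite f0 !addr0 => fk.
by rewrite [RHS]fk.
Qed.

HB.instance Definition _ := GRing.Lmodule_isLalgebra.Build R[i] boundedOp
  op_scalerAl.
HB.instance Definition _ := GRing.Lalgebra_isAlgebra.Build R[i] boundedOp
  op_scalerAr.

Definition opnorm (f : boundedOp) : R :=
  sup [set rnorm (f x) | x in [set x | rnorm x <= 1]].

Let op0 (f : boundedOp) : f 0 = 0.
Proof.
have := boundedOp_linear f 1 0 0; rewrite !scale1r addr0.
by move/eqP; rewrite -subr_eq0 opprD addrA subrr sub0r oppr_eq0 => /eqP.
Qed.

Let opZ (f : boundedOp) k x : f (k *: x) = k *: f x.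
Proof. by have := boundedOp_linear f k x 0; rewrite op0 !addr0. Qed.

Let opnorm_has_sup (f : boundedOp) :
  has_sup [set rnorm (f x) | x in [set x | rnorm x <= 1]].
Proof.
split; first by exists (rnorm (f 0)), 0 => //=; rewrite rnorm0.
have [M fM] := boundedOp_bounded f; exists `|M| => _ [x /= x1 <-].
rewrite (le_trans (fM _))// (@le_trans _ _ (`|M| * rnorm x))//.
  by rewrite ler_wpM2r ?rnorm_ge0// ler_norm.
by rewrite ler_piMr.
Qed.

Lemma opnorm_ge0 (f : boundedOp) : 0 <= opnorm f.
Proof.
apply: (le_trans (rnorm_ge0 (f 0))); apply: sup_upper_bound => //.
by exists 0 => //=; rewrite rnorm0.
Qed.

Lemma opnorm_bound (f : boundedOp) x : rnorm (f x) <= opnorm f * rnorm x.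
Proof.
have [->|x0] := eqVneq x 0; first by rewrite op0 !rnorm0 mulr0.
have rx0 : rnorm x != 0 by rewrite rnorm_eq0.
have rx_gt0 : 0 < rnorm x by rewrite lt0r rx0 rnorm_ge0.
pose k : R[i] := ((rnorm x)^-1)%:C.
have kE : rnorm k = (rnorm x)^-1.
  by rewrite /rnorm /k ger0_norm// lecR invr_ge0 rnorm_ge0.
have : rnorm (f (k *: x)) <= opnorm f.
  apply: sup_upper_bound => //; exists (k *: x) => //=.
  by rewrite rnormZ kE mulVf.
by rewrite opZ rnormZ kE ler_pdivrMl// mulrC.
Qed.

Lemma opnorm_le (f : boundedOp) (M : R) : 0 <= M ->
  (forall x, rnorm (f x) <= M * rnorm x) -> opnorm f <= M.
Proof.
move=> M0 fM; apply: ge_sup; first by case: (opnorm_has_sup f).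
by move=> _ [x /= x1 <-]; rewrite (le_trans (fM _))// ler_piMr.
Qed.

Let opnormD (f g : boundedOp) : opnorm (f + g) <= opnorm f + opnorm g.
Proof.
apply: opnorm_le => [|x]; first by rewrite addr_ge0 ?opnorm_ge0.
by rewrite (le_trans (rnormD _ _))// mulrDl lerD ?opnorm_bound.
Qed.

Let opnormZ_le (k : R[i]) (f : boundedOp) :
  opnorm (k *: f) <= rnorm k * opnorm f.
Proof.
apply: opnorm_le => [|x]; first by rewrite mulr_ge0 ?rnorm_ge0 ?opnorm_ge0.
by rewrite [leLHS]rnormZ -mulrA ler_wpM2l ?rnorm_ge0 ?opnorm_bound.
Qed.

Let opnorm0 : opnorm 0 = 0.
Proof.
apply/le_anti; rewrite opnorm_ge0 andbT; apply: opnorm_le => // x.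
by rewrite mul0r rnorm0.
Qed.

Let opnormZ (k : R[i]) (f : boundedOp) : opnorm (k *: f) = rnorm k * opnorm f.
Proof.
have [->|k0] := eqVneq k 0; first by rewrite scale0r opnorm0 rnorm0 mul0r.
have rk0 : 0 < rnorm k by rewrite lt0r rnorm_eq0 k0 rnorm_ge0.
apply/le_anti; rewrite opnormZ_le/=.
have := opnormZ_le k^-1 (k *: f); rewrite scalerA mulVf// scale1r.
have -> : rnorm k^-1 = (rnorm k)^-1.
  by apply: complexI; rewrite fmorphV/= -!rnormE normfV.
by rewrite ler_pdivlMl.
Qed.

Let opnorm0_eq0 (f : boundedOp) : opnorm f = 0 -> f = 0.
Proof.
move=> f0; apply: op_ext => x; apply/eqP; rewrite -rnorm_eq0.
by rewrite eq_le rnorm_ge0 andbT (le_trans (opnorm_bound _ _))// f0 mul0r.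
Qed.

Let opnormM (f g : boundedOp) : opnorm (f * g) <= opnorm f * opnorm g.
Proof.
apply: opnorm_le => [|x]; first by rewrite mulr_ge0 ?opnorm_ge0.
rewrite (le_trans (opnorm_bound f (g x)))// -mulrA.
by rewrite ler_wpM2l ?opnorm_ge0 ?opnorm_bound.
Qed.

HB.instance Definition _ := isNormedAlgebra.Build R boundedOp
  opnormD opnormZ opnorm0_eq0 opnormM.

End BoundedOperators.

(* Main.v *)
(* Let P_n be the orthogonal projection onto the span of the first n terms of a
   dense sequence of H. A fixed operator a sends the range of P_n, up to a small
   error, into that of P_m for m large, and P_n a (1 - P_m) tends to 0 in norm. For
   fast growing n_0 < n_1 < ... the commutators [P_(n_k), a] are therefore
   essentially block operators with orthogonal ranges or orthogonal supports, so
   that the mean of N of the P_(n_k) has a commutator with a of norm O(1/sqrt N).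
   The means of finite sequences of P_n's form a countable family, and the sets of
   means almost commuting with finitely many given operators generate a proper
   filter on this family. For any ultrafilter containing it, the family itself is
   a central sequence; it is not scalar, since every fixed vector of some P_n is
   eventually fixed by the means, while each mean has a nontrivial kernel. *)
Require Import Defs.
From mathcomp Require Import all_boot all_order all_algebra.
From mathcomp Require Import complex boolp classical_sets reals filter topology normedtype.
From mathcomp Require Import functions cardinality sequences ring lra.

Set Implicit Arguments.
Unset Strict Implicit.
Unset Printing Implicit Defensive.

Import Order.TTheory GRing.Theory Num.Theory.
Import numFieldNormedType.Exports.

Local Open Scope classical_set_scope.
Local Open Scope ring_scope.

(** * Norm and inner product: Pythagoras and Cauchy-Schwarz *)

Section RnormDot.
Context (R : realType).
Implicit Type H : hilbertType R.

Lemma rnormN (V : normedZmodType R[i]) (x : V) : rnorm (- x) = rnorm x.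
Proof. by rewrite /rnorm normrN. Qed.

Lemma rnormB (V : normedZmodType R[i]) (x y : V) :
  rnorm (x - y) <= rnorm x + rnorm y.
Proof. by rewrite -(rnormN y) rnormD. Qed.

Lemma rnorm_sum (V : normedZmodType R[i]) (I : Type) (r : seq I) (F : I -> V) :
  rnorm (\sum_(i <- r) F i) <= \sum_(i <- r) rnorm (F i).
Proof.
elim: r => [|i r IHr]; first by rewrite !big_nil rnorm0.
by rewrite !big_cons (le_trans (rnormD _ _))// lerD2l.
Qed.

Lemma hdotC H (x y : H) : hdot x y = (hdot y x)^*.
Proof. by rewrite hermC mul1r. Qed.

Lemma hdotDl H (x y z : H) : hdot (x + y) z = hdot x z + hdot y z.
Proof. exact: linearDl. Qed.

Lemma hdotBl H (x y z : H) : hdot (x - y) z = hdot x z - hdot y z.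
Proof. exact: linearBl. Qed.

Lemma hdotZl H c (x z : H) : hdot (c *: x) z = c * hdot x z.
Proof. exact: linearZl_LR. Qed.

Lemma hdotDr H (x y z : H) : hdot x (y + z) = hdot x y + hdot x z.
Proof. exact: linearDr. Qed.

Lemma hdotBr H (x y z : H) : hdot x (y - z) = hdot x y - hdot x z.
Proof. exact: linearBr. Qed.

Lemma hdotZr H c (x z : H) : hdot x (c *: z) = c^* * hdot x z.
Proof. exact: linearZr_LR. Qed.

Lemma hdot_rnorm H (x : H) : hdot x x = (rnorm x ^+ 2)%:C%C.
Proof. by rewrite hdot_norm rnormE rmorphXn. Qed.

Lemma rnorm_pythagoras H (x y : H) : hdot x y = 0 ->
  rnorm (x + y) ^+ 2 = rnorm x ^+ 2 + rnorm y ^+ 2.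
Proof.
move=> xy; apply: (@complexI R); rewrite rmorphD/= -!hdot_rnorm.
by rewrite hdotDl !hdotDr (hdotC y x) xy rmorph0 addr0 add0r.
Qed.

(** Pythagoras for [x] as its component along [u] plus an orthogonal remainder. *)
Lemma rnorm_dot_unit H (x u : H) : rnorm u = 1 -> rnorm (hdot x u) <= rnorm x.
Proof.
move=> u1; have uu : hdot u u = 1 by rewrite hdot_rnorm u1 expr1n.
rewrite -(@ler_pXn2r _ 2) ?nnegrE ?rnorm_ge0//.
have := @rnorm_pythagoras _ (x - hdot x u *: u) (hdot x u *: u).
rewrite subrK rnormZ u1 mulr1 => ->; first by rewrite lerDr sqr_ge0.
by rewrite hdotZr hdotBl hdotZl uu mulr1 subrr mulr0.
Qed.

Lemma rnorm_real (r : R) : rnorm (r%:C%C : R[i]) = `|r|.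
Proof. by apply: complexI; rewrite -rnormE normc_def/= expr0n addr0 sqrtr_sqr. Qed.

Lemma rnorm_dot H (x y : H) : rnorm (hdot x y) <= rnorm x * rnorm y.
Proof.
have [->|y0] := eqVneq y 0; first by rewrite (linear0r hdot) !rnorm0 mulr0.
have ry0 : 0 < rnorm y by rewrite lt0r rnorm_eq0 y0 rnorm_ge0.
have u1 : rnorm (((rnorm y)^-1)%:C%C *: y) = 1.
  by rewrite rnormZ rnorm_real ger0_norm ?invr_ge0 ?ltW// mulVf ?gt_eqF.
have := rnorm_dot_unit x u1.
rewrite -ler_pdivrMr// hdotZr; apply: le_trans.
rewrite le_eqVlt; apply/orP; left; apply/eqP.
apply: complexI; rewrite -rnormE normrM norm_conjC rmorphM/= -!rnormE mulrC.
by congr (_ * _); rewrite rnormE rnorm_real ger0_norm // invr_ge0 ltW.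
Qed.

End RnormDot.

(** * Linearity and norm bounds of operators *)

Section BoundedOpTheory.
Context (R : realType) (H : infHilbertType R).
Implicit Types a b : boundedOp H.

Lemma boundedOpB a x y : a (x - y) = a x - a y.
Proof.
by rewrite addrC -scaleN1r boundedOp_linear scaleN1r addrC.
Qed.

Lemma boundedOp0 a : a 0 = 0.
Proof. by have := boundedOpB a 0 0; rewrite !subrr. Qed.

Lemma boundedOpZ a k x : a (k *: x) = k *: a x.
Proof. by have := boundedOp_linear a k x 0; rewrite boundedOp0 !addr0. Qed.

Lemma boundedOpD a x y : a (x + y) = a x + a y.
Proof. by have := boundedOp_linear a 1 x y; rewrite !scale1r. Qed.

Lemma boundedOp_sum a (I : Type) (r : seq I) (F : I -> H) :
  a (\sum_(i <- r) F i) = \sum_(i <- r) a (F i).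
Proof. exact: (big_morph a (boundedOpD a) (boundedOp0 a)). Qed.

Lemma sum_boundedOpE (I : Type) (r : seq I) (F : I -> boundedOp H) x :
  (\sum_(i <- r) F i) x = \sum_(i <- r) F i x.
Proof. exact: (big_morph (fun a : boundedOp H => a x)). Qed.

Lemma anorm_bound a x : rnorm (a x) <= anorm a * rnorm x.
Proof. exact: opnorm_bound. Qed.

Lemma anorm_le a (M : R) : 0 <= M ->
  (forall x, rnorm (a x) <= M * rnorm x) -> anorm a <= M.
Proof. exact: opnorm_le. Qed.

End BoundedOpTheory.

(** * Gram-Schmidt projections of a sequence *)

Section GramSchmidt.
Context (R : realType) (H : infHilbertType R) (d : nat -> H).

(* As [0^-1 = 0], [normalize 0 = 0]: the terms of [d] that depend linearly on the
   previous ones contribute zero vectors to the orthonormal family [gs_vec]. *)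
Definition normalize (v : H) : H := ((rnorm v)^-1)%:C%C *: v.

Fixpoint gs_proj n : H -> H := if n is m.+1 then
  let u := normalize (d m - gs_proj m (d m)) in
  fun x => gs_proj m x + hdot x u *: u
  else fun=> 0.

Definition gs_vec n := normalize (d n - gs_proj n (d n)).

Lemma gs_projS n x : gs_proj n.+1 x = gs_proj n x + hdot x (gs_vec n) *: gs_vec n.
Proof. by []. Qed.

Lemma rnorm_normalize (v : H) : v != 0 -> rnorm (normalize v) = 1.
Proof.
move=> v0; rewrite rnormZ rnorm_real ger0_norm ?invr_ge0 ?rnorm_ge0//.
by rewrite mulVf// rnorm_eq0.
Qed.

Lemma normalize0 : normalize 0 = 0. Proof. by rewrite /normalize scaler0. Qed.

Lemma gs_vec_unit n : gs_vec n = 0 \/ rnorm (gs_vec n) = 1.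
Proof.
rewrite /gs_vec; case: (eqVneq (d n - gs_proj n (d n)) 0) => [->|v0].
  by left; rewrite normalize0.
by right; exact: rnorm_normalize.
Qed.

(** Valid for unit and for zero vectors, so later arguments need not tell them apart. *)
Lemma gs_vecZ n : hdot (gs_vec n) (gs_vec n) *: gs_vec n = gs_vec n.
Proof.
have [->|u1] := gs_vec_unit n; first by rewrite scaler0.
by rewrite hdot_rnorm u1 expr1n scale1r.
Qed.

Lemma gs_proj_linear n : linear (gs_proj n).
Proof.
elim: n => [|n IHn] k x y; first by rewrite scaler0 addr0.
rewrite !gs_projS IHn; move: (gs_vec n) => u.
rewrite hdotDl hdotZl scalerDl scalerDr -(scalerA k).
exact: addrACA.
Qed.

Lemma gs_projB n x y : gs_proj n (x - y) = gs_proj n x - gs_proj n y.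
Proof. by rewrite addrC -scaleN1r gs_proj_linear scaleN1r addrC. Qed.

Lemma gs_proj0 n : gs_proj n 0 = 0.
Proof. by have := gs_projB n 0 0; rewrite !subrr. Qed.

Lemma gs_projZ n k x : gs_proj n (k *: x) = k *: gs_proj n x.
Proof. by have := gs_proj_linear n k x 0; rewrite gs_proj0 !addr0. Qed.

Lemma gs_projD n x y : gs_proj n (x + y) = gs_proj n x + gs_proj n y.
Proof. by have := gs_proj_linear n 1 x y; rewrite !scale1r. Qed.

Lemma gs_proj_sym n x y : hdot (gs_proj n x) y = hdot x (gs_proj n y).
Proof.
elim: n => [|n IHn]; first by rewrite (linear0l hdot) (linear0r hdot).
rewrite !gs_projS; move: (gs_vec n) => u.
by rewrite hdotDl hdotDr IHn hdotZl hdotZr (hdotC u y) mulrC.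
Qed.

(** The two claims feed each other: idempotence at [n] makes the projection kill [gs_vec n], and
    this with self-adjointness gives idempotence at [n.+1]. *)
Lemma gs_proj_idem n : (forall x, gs_proj n (gs_proj n x) = gs_proj n x) /\
  gs_proj n (gs_vec n) = 0.
Proof.
have vec0 m : (forall x, gs_proj m (gs_proj m x) = gs_proj m x) ->
    gs_proj m (gs_vec m) = 0.
  by move=> idem; rewrite /gs_vec gs_projZ gs_projB idem subrr scaler0.
elim: n => [|n [idem uO]]; first by split=> //; exact: vec0.
suff idemS x : gs_proj n.+1 (gs_proj n.+1 x) = gs_proj n.+1 x.
  by split=> //; exact: vec0.
rewrite !gs_projS gs_projD gs_projZ idem uO scaler0 addr0.
rewrite hdotDl gs_proj_sym uO (linear0r hdot) add0r hdotZl.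
by rewrite -scalerA gs_vecZ.
Qed.

Lemma gs_proj_vec m n : (m <= n)%N -> gs_proj m (gs_vec n) = 0.
Proof.
move=> mn; suff projK k x : gs_proj m (gs_proj (k + m) x) = gs_proj m x.
  by have [_ uO] := gs_proj_idem n; rewrite -(projK (n - m)%N) subnK// uO gs_proj0.
elim: k x => [|k IHk] x; first by case: (gs_proj_idem m).
have [_ uO] := gs_proj_idem (k + m).
rewrite addSn gs_projS gs_projD IHk gs_projZ.
by rewrite -(IHk (gs_vec _)) uO gs_proj0 scaler0 addr0.
Qed.

Lemma gs_projK m n x : (m <= n)%N -> gs_proj m (gs_proj n x) = gs_proj m x.
Proof.
move=> /subnK <-; elim: (n - m)%N => [|k IHk]; first by case: (gs_proj_idem m).
by rewrite addSn gs_projS gs_projD IHk gs_projZ gs_proj_vec ?leq_addl// scaler0 addr0.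
Qed.

Lemma gs_projKr m n x : (m <= n)%N -> gs_proj n (gs_proj m x) = gs_proj m x.
Proof.
move=> /subnK <-; elim: (n - m)%N => [|k IHk]; first by case: (gs_proj_idem m).
rewrite addSn gs_projS IHk gs_proj_sym gs_proj_vec ?leq_addl//.
by rewrite (linear0r hdot) scale0r addr0.
Qed.

Lemma gs_proj_rnormD n x y : gs_proj n x = x -> gs_proj n y = 0 ->
  rnorm (x + y) ^+ 2 = rnorm x ^+ 2 + rnorm y ^+ 2.
Proof.
move=> xE y0; apply: rnorm_pythagoras.
by rewrite -xE gs_proj_sym y0 (linear0r hdot).
Qed.

Lemma rnorm_gs_proj n x : rnorm (gs_proj n x) <= rnorm x.
Proof.
rewrite -(@ler_pXn2r _ 2) ?nnegrE ?rnorm_ge0//.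
have := @gs_proj_rnormD n (gs_proj n x) (x - gs_proj n x).
rewrite (addrC (gs_proj n x)) subrK gs_projB gs_projK// subrr => ->//.
by rewrite lerDl sqr_ge0.
Qed.

Lemma gs_proj_bounded n : gs_proj n \in @bounded_linear R H.
Proof.
apply/bounded_linearP; split; first exact: gs_proj_linear.
by exists 1 => x; rewrite mul1r rnorm_gs_proj.
Qed.

Definition gs_op n : boundedOp H := BoundedOp (gs_proj_bounded n).

(** The new rank-one term sends [d n] to its component [v] orthogonal to the previous terms; if
    [v = 0], that term vanishes. *)
Lemma gs_projS_id n : gs_proj n.+1 (d n) = d n.
Proof.
rewrite gs_projS; set v := d n - gs_proj n (d n).
have dE : d n = gs_proj n (d n) + v by rewrite addrC /v subrK.
have -> : hdot (d n) (gs_vec n) = hdot v (gs_vec n).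
  by rewrite {1}dE hdotDl gs_proj_sym gs_proj_vec// (linear0r hdot) add0r.
rewrite [RHS]dE; congr (_ + _); rewrite /gs_vec -/v.
have [->|v0] := eqVneq v 0; first by rewrite normalize0 scaler0.
rewrite /normalize hdotZr hdot_rnorm.
have -> : (((rnorm v)^-1)%:C%C)^* = ((rnorm v)^-1)%:C%C :> R[i].
  by apply/CrealP; rewrite complex_real.
rewrite scalerA -!rmorphM/= expr2 mulrA mulVf ?rnorm_eq0// mul1r.
by rewrite mulfV ?rnorm_eq0// scale1r.
Qed.

Lemma gs_proj_id m n : (m < n)%N -> gs_proj n (d m) = d m.
Proof. by move=> mn; rewrite -gs_projS_id gs_projKr. Qed.

Lemma gs_projE n x : gs_proj n x = \sum_(i < n) hdot x (gs_vec i) *: gs_vec i.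
Proof. by elim: n => [|n IHn]; rewrite ?big_ord0// big_ord_recr -IHn. Qed.

End GramSchmidt.

(** * Tails of a bounded operator relative to the projections *)

Section Tails.
Context (R : realType) (H : infHilbertType R) (d : nat -> H).
Hypothesis d_dense : forall x (e : R), 0 < e -> exists n, rnorm (x - d n) < e.
Local Notation P n := (gs_op d n).
Implicit Types (a : boundedOp H) (e : R).

Lemma gs_opK m n x : (m <= n)%N -> P m (P n x) = P m x.
Proof. exact: gs_projK. Qed.

Lemma gs_opKr m n x : (m <= n)%N -> P n (P m x) = P m x.
Proof. exact: gs_projKr. Qed.

Lemma gs_op_vec m n : (m <= n)%N -> P m (gs_vec d n) = 0.
Proof. exact: gs_proj_vec. Qed.

Lemma gs_opS n x : P n.+1 x = P n x + hdot x (gs_vec d n) *: gs_vec d n.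
Proof. exact: gs_projS. Qed.

Lemma rnorm_gs_op n x : rnorm (P n x) <= rnorm x.
Proof. exact: rnorm_gs_proj. Qed.

Lemma gs_op_rnormD n x y : P n x = x -> P n y = 0 ->
  rnorm (x + y) ^+ 2 = rnorm x ^+ 2 + rnorm y ^+ 2.
Proof. exact: gs_proj_rnormD. Qed.

Lemma rnorm_sub_gs_op n x : rnorm (x - P n x) <= rnorm x.
Proof.
rewrite -(@ler_pXn2r _ 2) ?nnegrE ?rnorm_ge0//.
have := @gs_op_rnormD n (P n x) (x - P n x).
rewrite (addrC (P n x)) subrK boundedOpB !gs_opK// subrr => ->//.
by rewrite lerDr sqr_ge0.
Qed.

(** For [n > k] the projection fixes [d k], so the error at [x] equals the error at [x - d k], which
    is small by density. *)
Lemma gs_op_cvg x e : 0 < e -> \forall n \near \oo, rnorm (x - P n x) <= e.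
Proof.
move=> /d_dense-/(_ x)[k xk]; near=> n.
have kn : (k < n)%N by near: n; exact: nbhs_infty_gt.
have -> : x - P n x = (x - d k) - P n (x - d k).
  have Pd : P n (d k) = d k by exact: gs_proj_id.
  by rewrite boundedOpB Pd opprB addrA subrK.
exact: le_trans (rnorm_sub_gs_op _ _) (ltW xk).
Unshelve. all: by end_near. Qed.

Lemma le_rnorm_gs_vec n x : rnorm (hdot x (gs_vec d n)) <= rnorm x.
Proof.
have [->|/rnorm_dot_unit//] := gs_vec_unit d n.
by rewrite (linear0r hdot) rnorm0 rnorm_ge0.
Qed.

(** The range of [P n] is spanned by finitely many vectors, so pointwise convergence of the
    projections becomes uniform; each new vector costs half of the error. *)
Lemma gs_op_tail_left a n e : 0 < e ->
  \forall m \near \oo, forall x, rnorm (a (P n x) - P m (a (P n x))) <= e * rnorm x.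
Proof.
elim: n e => [|n IHn] e e0.
  near=> m => x; have -> : P 0%N x = 0 by [].
  by rewrite !boundedOp0 subrr rnorm0 mulr_ge0 ?rnorm_ge0// ltW.
have e20 : 0 < e / 2 by rewrite divr_gt0.
near=> m => x; rewrite gs_opS; set u := gs_vec d n; set c := hdot x u.
have -> : a (P n x + c *: u) - P m (a (P n x + c *: u)) =
    a (P n x) - P m (a (P n x)) + c *: (a u - P m (a u)).
  by rewrite !boundedOpD !boundedOpZ scalerBr opprD addrACA.
rewrite [e]splitr mulrDl (le_trans (rnormD _ _))// lerD//.
  by move: (x); near: m; exact: IHn.
rewrite rnormZ mulrC ler_pM ?rnorm_ge0 ?le_rnorm_gs_vec//.
by near: m; exact: gs_op_cvg.
Unshelve. all: by end_near. Qed.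

(* [gs_riesz a v n] is the projection onto the span of the first [n] vectors
   of the Riesz representative of the functional [x |-> hdot (a x) v]. *)
Fixpoint gs_riesz a v n : H := if n is m.+1 then
  gs_riesz a v m + hdot v (a (gs_vec d m)) *: gs_vec d m else 0.

Lemma gs_rieszS a v n :
  gs_riesz a v n.+1 = gs_riesz a v n + hdot v (a (gs_vec d n)) *: gs_vec d n.
Proof. by []. Qed.

Lemma gs_rieszP a v n x : hdot x (gs_riesz a v n) = hdot (a (P n x)) v.
Proof.
elim: n => [|n IHn].
  by rewrite /= boundedOp0 (linear0r hdot) (linear0l hdot).
rewrite gs_opS gs_rieszS; move: (gs_vec d n) => u.
rewrite boundedOpD boundedOpZ hdotDr hdotDl hdotZl hdotZr IHn.
by rewrite (hdotC (a u)) mulrC.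
Qed.

Lemma gs_op_riesz a v m n : (m <= n)%N -> P m (gs_riesz a v n) = gs_riesz a v m.
Proof.
have id k : P k (gs_riesz a v k) = gs_riesz a v k.
  elim: k => [//|k IHk]; rewrite gs_rieszS boundedOpD boundedOpZ.
  have -> : P k.+1 (gs_riesz a v k) = gs_riesz a v k by rewrite -{1}IHk gs_opKr.
  by rewrite gs_opS gs_op_vec// add0r gs_vecZ.
move=> /subnK <-; elim: (n - m)%N => [|k IHk]; first exact: id.
by rewrite addSn gs_rieszS boundedOpD IHk boundedOpZ gs_op_vec ?leq_addl// scaler0 addr0.
Qed.

(** Test the functional on [y] itself: [hdot y y = hdot (a y) v]. *)
Lemma rnorm_gs_riesz a v n : rnorm (gs_riesz a v n) <= anorm a * rnorm v.
Proof.
set y := gs_riesz a v n; have [->|y0] := eqVneq y 0.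
  by rewrite rnorm0 mulr_ge0 ?rnorm_ge0 ?anorm_ge0.
have ry : 0 < rnorm y by rewrite lt0r rnorm_eq0 y0 rnorm_ge0.
rewrite -(ler_pM2l ry).
have -> : rnorm y * rnorm y = rnorm (hdot y y).
  by rewrite hdot_rnorm rnorm_real ger0_norm ?sqr_ge0.
rewrite {2}/y gs_rieszP gs_op_riesz// -/y mulrCA mulrA.
by rewrite (le_trans (rnorm_dot _ _))// ler_wpM2r ?rnorm_ge0// anorm_bound.
Qed.

(** By Pythagoras the squared norms increase by the squared norms of the increments; being bounded,
    they come within [e ^+ 2] of their supremum. *)
Lemma gs_riesz_cauchy a v e : 0 < e -> \forall m \near \oo, forall n, (m <= n)%N ->
  rnorm (gs_riesz a v n - gs_riesz a v m) <= e.
Proof.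
move=> e0; pose y := gs_riesz a v.
have diff m n : (m <= n)%N ->
    rnorm (y n) ^+ 2 = rnorm (y m) ^+ 2 + rnorm (y n - y m) ^+ 2.
  move=> mn; have := @gs_op_rnormD m (y m) (y n - y m).
  rewrite (addrC (y m)) subrK boundedOpB !gs_op_riesz// subrr => -> //.
pose S := [set rnorm (y n) ^+ 2 | n in [set: nat]].
have supS : has_sup S.
  split; first by exists (rnorm (y 0%N) ^+ 2), 0%N.
  exists ((anorm a * rnorm v) ^+ 2) => _ [n _ <-].
  by rewrite lerXn2r ?nnegrE ?rnorm_ge0 ?mulr_ge0 ?anorm_ge0 ?rnorm_ge0// rnorm_gs_riesz.
have [_ [k _ <-] hk] := sup_adherent (exprn_gt0 2 e0) supS.
near=> m => n mn.
have km : (k <= m)%N by near: m; exact: nbhs_infty_ge.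
rewrite -(@ler_pXn2r _ 2) ?nnegrE ?rnorm_ge0 ?(ltW e0)//.
have := diff _ _ km; have := diff _ _ mn.
have : rnorm (y n) ^+ 2 <= sup S by apply: sup_upper_bound => //; exists n.
have := sqr_ge0 (rnorm (y m - y k)).
rewrite -/(y n) -/(y m); lra.
Unshelve. all: by end_near. Qed.

(** Between [P m] and [P n] the functional is the inner product with a difference of [gs_riesz]
    vectors, small uniformly in [n]. The index [n], chosen after [x], makes the rest arbitrarily
    small. *)
Lemma gs_functional_tail a v e : 0 < e ->
  \forall m \near \oo, forall x, rnorm (hdot (a (x - P m x)) v) <= e * rnorm x.
Proof.
move=> e0; near=> m => x; apply/ler_addgt0Pr => t t0.
pose C := anorm a * rnorm v.
have C0 : 0 <= C by rewrite mulr_ge0 ?anorm_ge0 ?rnorm_ge0.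
pose s := t / (C + 1).
(* The [1] added to [C] keeps the denominator positive and still gives [C * s <= t]. *)
have s0 : 0 < s by rewrite divr_gt0// ltr_wpDl.
have [n [mn xn]] : exists n, (m <= n)%N /\ rnorm (x - P n x) <= s.
  have [n [? ?]] : exists n, rnorm (x - P n x) <= s /\ (m <= n)%N.
    by apply: (@filter_ex _ \oo); apply: filterI; [exact: gs_op_cvg|exact: nbhs_infty_ge].
  by exists n.
have -> : x - P m x = (P n x - P m x) + (x - P n x) by rewrite [RHS]addrC addrA subrK.
rewrite boundedOpD hdotDl (le_trans (rnormD _ _))// lerD//.
  rewrite boundedOpB hdotBl -!gs_rieszP -hdotBr (le_trans (rnorm_dot _ _))//.
  rewrite mulrC ler_wpM2r ?rnorm_ge0//.
  by move: (n) mn; near: m; exact: gs_riesz_cauchy.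
rewrite (le_trans (rnorm_dot _ _))// (@le_trans _ _ (C * s))//.
  rewrite /C mulrAC ler_wpM2r ?rnorm_ge0// (le_trans (anorm_bound _ _))//.
  by rewrite ler_wpM2l ?anorm_ge0.
rewrite /s mulrCA ler_piMr ?(ltW t0)// ler_pdivrMr ?ltr_wpDl// mul1r; lra.
Unshelve. all: by end_near. Qed.

(** Composing with [P n] leaves finitely many functionals [hdot (a _) (gs_vec d i)], each with a
    small tail. *)
Lemma gs_op_tail_right a n e : 0 < e ->
  \forall m \near \oo, forall x, rnorm (P n (a (x - P m x))) <= e * rnorm x.
Proof.
elim: n e => [|n IHn] e e0.
  near=> m => x; rewrite (_ : P 0%N _ = 0)//.
  by rewrite rnorm0 mulr_ge0 ?rnorm_ge0// ltW.
have e20 : 0 < e / 2 by rewrite divr_gt0.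
near=> m => x; rewrite gs_opS [e]splitr mulrDl (le_trans (rnormD _ _))// lerD//.
  by move: (x); near: m; exact: IHn.
rewrite rnormZ.
have u1 : rnorm (gs_vec d n) <= 1.
  by have [->|->//] := gs_vec_unit d n; rewrite rnorm0.
rewrite (le_trans (ler_wpM2l (rnorm_ge0 _) u1))// mulr1.
by move: (x); near: m; exact: gs_functional_tail.
Unshelve. all: by end_near. Qed.

End Tails.

(** * Sums of commutators along a chain of projections *)

Lemma sqr_sum_le (R : realFieldType) (s : nat -> R) n :
  (forall k, 0 <= s k) ->
  (\sum_(0 <= k < n) s k) ^+ 2 <= n%:R * \sum_(0 <= k < n) s k ^+ 2.
Proof.
move=> s0; elim: n => [|n]; first by rewrite !big_geq// expr0n mulr0.
rewrite !big_nat_recr//; set S := \sum_(0 <= k < n) _; set T := \sum_(0 <= k < n) _ => ST.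
have S0 : 0 <= S by exact: sumr_ge0.
have T0 : 0 <= T by apply: sumr_ge0 => k _; exact: sqr_ge0.
have n0 : 0 <= n%:R :> R by [].
(* AM-GM: by induction the left side squared is at most [4 * n * T * s n ^ 2], hence at most the
   right side squared. *)
have : 2 * S * s n <= T + n%:R * s n ^+ 2.
  rewrite -(@ler_pXn2r _ 2) ?nnegrE ?addr_ge0 ?mulr_ge0 ?sqr_ge0//.
  have : S ^+ 2 * s n ^+ 2 <= n%:R * T * s n ^+ 2 by rewrite ler_wpM2r ?sqr_ge0.
  have := sqr_ge0 (T - n%:R * s n ^+ 2).
  by rewrite !expr2; move: (n%:R) (s n) S T {ST S0 T0 n0} => N t S T; nra.
rewrite -(natr1 n) => St; rewrite -subr_ge0.
have -> : (n%:R + 1) * (T + s n ^+ 2) - (S + s n) ^+ 2 =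
  (n%:R * T - S ^+ 2) + (T + n%:R * s n ^+ 2 - 2 * S * s n) by ring.
by rewrite addr_ge0 ?subr_ge0.
Qed.

Section Commutator.
Context (R : realType) (H : infHilbertType R) (d : nat -> H).
Local Notation P n := (gs_op d n).

Section Chain.
Variable c : nat -> nat.
Hypothesis c_mono : forall k, (c k <= c k.+1)%N.

Let c_le j k : (j <= k)%N -> (c j <= c k)%N.
Proof. exact: (homo_leq (leqnn) leq_trans c_mono). Qed.

Let Q k : boundedOp H := P (c k.+1) - P (c k).

Let QE k x : Q k x = P (c k.+1) x - P (c k) x. Proof. by []. Qed.

(** Bessel's inequality for the orthogonal increments [Q k]. *)
Lemma sum_sqr_diff_gs_op n x : \sum_(0 <= k < n) rnorm (Q k x) ^+ 2 <= rnorm x ^+ 2.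
Proof.
suff : \sum_(0 <= k < n) rnorm (Q k x) ^+ 2 <= rnorm (P (c n) x) ^+ 2.
  move=> /le_trans; apply.
  by rewrite ler_pXn2r ?nnegrE ?rnorm_ge0// rnorm_gs_op.
elim: n => [|n IHn]; first by rewrite big_geq// sqr_ge0.
rewrite big_nat_recr//.
have -> : P (c n.+1) x = P (c n) x + Q n x by rewrite QE addrC subrK.
rewrite (@gs_op_rnormD _ _ d (c n)) ?lerD2r ?gs_opK//.
by rewrite QE boundedOpB !gs_opK// subrr.
Qed.

(** The earlier terms lie in the range of [P (c n)], which kills the range of [Q n]; so the squared
    norms add up. *)
Lemma sqr_sum_diff_gs_op n (y : nat -> H) :
  rnorm (\sum_(0 <= k < n) Q k (y k)) ^+ 2 <= \sum_(0 <= k < n) rnorm (y k) ^+ 2.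
Proof.
elim: n => [|n IHn]; first by rewrite !big_geq// rnorm0 expr0n.
rewrite !big_nat_recr// (@gs_op_rnormD _ _ d (c n)).
- rewrite lerD// ler_pXn2r ?nnegrE ?rnorm_ge0//.
  rewrite QE -(gs_opK d (y n) (c_mono n)).
  exact: le_trans (rnorm_sub_gs_op _ _ _) (rnorm_gs_op _ _ _).
- rewrite boundedOp_sum; apply: eq_big_nat => k /andP[_ kn].
  by rewrite QE boundedOpB !gs_opKr ?c_le// ltnW.
- by rewrite QE boundedOpB !gs_opK// subrr.
Qed.

Variables (a : boundedOp H) (e : R).
Hypothesis a_left : forall k x,
  rnorm (a (P (c k) x) - P (c k.+1) (a (P (c k) x))) <= e * rnorm x.
Hypothesis a_right : forall k x,
  rnorm (P (c k) (a (x - P (c k.+1) x))) <= e * rnorm x.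

(* With [P_k] for [P (c k)], the commutator of [P_k] and [a] is
   [P_k a Q_k - Q_k a P_k] up to [2 e]; the ranges of the [Q_k] are
   orthogonal, so each of the two sums over [k] grows only like the square root
   of the number of terms. *)
Lemma commutator_sum_gs_op K x :
  rnorm (\sum_(0 <= k < K ^ 2) (P (c k) (a x) - a (P (c k) x))) <=
  2 * (K%:R * anorm a + (K ^ 2)%:R * e) * rnorm x.
Proof.
set N := (K ^ 2)%N.
have N2 : N%:R = K%:R ^+ 2 :> R by rewrite natrX.
have split_k k : P (c k) (a x) - a (P (c k) x) =
  (P (c k) (a (Q k x)) + P (c k) (a (x - P (c k.+1) x))) -
  (Q k (a (P (c k) x)) + (a (P (c k) x) - P (c k.+1) (a (P (c k) x)))).
  have -> : x - P (c k.+1) x = (x - P (c k) x) - Q k x.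
    by rewrite QE opprB addrA subrK.
  rewrite (boundedOpB a (x - _)) (boundedOpB (P (c k)) (a (x - _))) subrKC.
  rewrite (boundedOpB a x) (boundedOpB (P (c k)) (a x)) QE.
  set q := a (P (c k) x); set r := P _ q; set t := P _ q.
  by rewrite (addrC (t - r)) addrA subrK opprB addrA subrK.
rewrite (eq_bigr _ (fun k _ => split_k k)) sumrB.
rewrite (le_trans (rnormB _ _))// mulr_natl mulr2n mulrDl.
have KC : 0 <= K%:R * anorm a * rnorm x by rewrite !mulr_ge0 ?anorm_ge0 ?rnorm_ge0.
have err (F : nat -> H) : (forall k, rnorm (F k) <= e * rnorm x) ->
    rnorm (\sum_(0 <= k < N) F k) <= N%:R * e * rnorm x.
  move=> Fe; rewrite (le_trans (rnorm_sum _ _))//.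
  rewrite (le_trans (ler_sum _ (fun k _ => Fe k)))//.
  by rewrite sumr_const_nat subn0 -[leLHS]mulr_natl mulrA.
apply: lerD; rewrite big_split (le_trans (rnormD _ _))// mulrDl lerD//; try exact: err.
(* Orthogonal supports: Cauchy-Schwarz over [K ^ 2] terms gives the factor [K], and Bessel bounds
   the squares. *)
- pose s k := rnorm (Q k x).
  rewrite (le_trans (rnorm_sum _ _))//.
  rewrite (@le_trans _ _ (anorm a * \sum_(0 <= k < N) s k))//.
    rewrite mulr_sumr; apply: ler_sum => k _.
    exact: le_trans (rnorm_gs_op _ _ _) (anorm_bound _ _).
  rewrite (mulrC K%:R) -mulrA ler_wpM2l ?anorm_ge0//.
  rewrite -(@ler_pXn2r _ 2) ?nnegrE ?mulr_ge0 ?rnorm_ge0 ?sumr_ge0//; last first.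
    by move=> k _; exact: rnorm_ge0.
  rewrite (le_trans (sqr_sum_le _ _)); [by []|by move=> k; exact: rnorm_ge0|].
  by rewrite exprMn N2 ler_wpM2l ?sqr_ge0// sum_sqr_diff_gs_op.
(* Orthogonal ranges: [K ^ 2] squares, each at most [(anorm a * rnorm x) ^+ 2]. *)
- rewrite -(@ler_pXn2r _ 2) ?nnegrE ?rnorm_ge0//.
  apply: (le_trans (sqr_sum_diff_gs_op N (fun k => a (P (c k) x)))).
  rewrite (@le_trans _ _ (\sum_(0 <= k < N) (anorm a * rnorm x) ^+ 2))//.
    apply: ler_sum => k _.
    rewrite ler_pXn2r ?nnegrE ?rnorm_ge0 ?mulr_ge0 ?anorm_ge0 ?rnorm_ge0//.
    by rewrite (le_trans (anorm_bound _ _))// ler_wpM2l ?anorm_ge0 ?rnorm_gs_op.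
  by rewrite sumr_const_nat subn0 -[leLHS]mulr_natl N2 -(mulrA K%:R) (exprMn _ K%:R).
Qed.

End Chain.

Definition mean_gs_op (s : seq nat) : boundedOp H :=
  ((size s)%:R^-1)%:C%C *: \sum_(k <- s) P k.

Lemma mean_gs_opE s x :
  mean_gs_op s x = ((size s)%:R^-1)%:C%C *: \sum_(k <- s) P k x.
Proof. by rewrite -sum_boundedOpE. Qed.

Lemma anorm_mean_gs_op s : anorm (mean_gs_op s) <= 1.
Proof.
apply: anorm_le => // x; rewrite mul1r mean_gs_opE rnormZ rnorm_real.
rewrite ger0_norm ?invr_ge0//.
have [->|s0] := posnP (size s); first by rewrite invr0 mul0r rnorm_ge0.
rewrite ler_pdivrMl ?ltr0n// (le_trans (rnorm_sum _ _))//.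
rewrite (le_trans (ler_sum _ (fun k _ => rnorm_gs_op d k x)))//.
by rewrite big_const_seq count_predT iter_addr_0 mulr_natl.
Qed.

End Commutator.

(** * Means almost commuting with finitely many operators *)

Lemma near_all_in (T : eqType) (F : seq T) (Q : T -> nat -> Prop) :
  (forall a, \forall n \near \oo, Q a n) ->
  \forall n \near \oo, forall a, a \in F -> Q a n.
Proof.
move=> nearQ; elim: F => [|a F IHF]; first by near=> n => a; rewrite in_nil.
near=> n => b; rewrite inE => /predU1P[->|].
  by near: n; exact: nearQ.
by move: (b); near: n; exact: IHF.
Unshelve. all: by end_near. Qed.

Section AlmostCentral.
Context (R : realType) (H : infHilbertType R) (d : nat -> H).
Hypothesis d_dense : forall x (e : R), 0 < e -> exists n, rnorm (x - d n) < e.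
Local Notation P n := (gs_op d n).

Lemma exists_mean_commutator (F : seq (boundedOp H)) (M : nat) (e : R) : 0 < e ->
  exists s, [/\ s != [::], all (leq M) s & forall a, a \in F ->
    anorm (mean_gs_op d s * a - a * mean_gs_op d s) <= e].
Proof.
move=> e0; have e4 : 0 < e / 4 by rewrite divr_gt0.
(* Iterating [g] from [M] gives a chain along which both tails of every operator in [F] are at most
   [e / 4]. *)
have /choice[g gP] : forall n, exists m, (n <= m)%N /\ forall a, a \in F ->
    (forall x, rnorm (a (P n x) - P m (a (P n x))) <= e / 4 * rnorm x) /\
    (forall x, rnorm (P n (a (x - P m x))) <= e / 4 * rnorm x).
  move=> n; apply: (@filter_ex _ \oo); apply: filterI; first exact: nbhs_infty_ge.
  apply: near_all_in => a; apply: filterI.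
    exact: gs_op_tail_left.
  exact: gs_op_tail_right.
pose c k := iter k g M.
have c_mono k : (c k <= c k.+1)%N by case: (gP (c k)).
have Mc k : (M <= c k)%N by elim: k => // k IHk; exact: leq_trans (c_mono k).
(* The mean of [K ^ 2] projections has commutator at most [2 * anorm a / K + e / 2]; this [K] makes
   the first term at most [e / 2]. *)
have [K [K0 KF]] : exists K, (0 < K)%N /\
    forall a, a \in F -> 4 * anorm a <= K%:R * e.
  apply: (@filter_ex _ \oo); apply: filterI; first exact: nbhs_infty_gt.
  apply: near_all_in => a; near=> K; rewrite -ler_pdivrMr//.
  by near: K; exact: nbhs_infty_ger.
pose s := [seq c k | k <- index_iota 0 (K ^ 2)].
have sz : size s = (K ^ 2)%N by rewrite size_map size_iota subn0.
have N0 : (0 < K ^ 2)%N by rewrite expn_gt0 K0.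
exists s; split.
- by rewrite -size_eq0 sz -lt0n.
- by rewrite all_map; apply/allP => k _ /=.
move=> a aF; apply: anorm_le => [|x]; first exact: ltW.
have -> : (mean_gs_op d s * a - a * mean_gs_op d s) x =
    ((K ^ 2)%:R^-1)%:C%C *: \sum_(0 <= k < K ^ 2) (P (c k) (a x) - a (P (c k) x)).
  transitivity (mean_gs_op d s (a x) - a (mean_gs_op d s x)) => //.
  by rewrite !mean_gs_opE boundedOpZ boundedOp_sum -scalerBr sz !big_map sumrB.
rewrite rnormZ rnorm_real ger0_norm ?invr_ge0// ler_pdivrMl ?ltr0n//.
apply: (le_trans (@commutator_sum_gs_op _ _ d c c_mono a (e / 4) _ _ K x)).
- by move=> k y; have [_ /(_ a aF)[]] := gP (c k).
- by move=> k y; have [_ /(_ a aF)[]] := gP (c k).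
rewrite [leRHS]mulrA ler_wpM2r ?rnorm_ge0//.
have := ler_wpM2l (ler0n R K) (KF a aF); rewrite natrX expr2; lra.
Unshelve. all: by end_near. Qed.

End AlmostCentral.

(** * A dense sequence, fixed vectors and kernels of the means *)

Lemma separable_dense_seq (R : realType) (H : infHilbertType R) :
  separable_space H ->
  exists d : nat -> H, forall x (e : R), 0 < e -> exists n, rnorm (x - d n) < e.
Proof.
move=> [S [/countable_injP[f f_inj] S_dense]].
(* The point of [S] that [f] numbers [n], or [0] if there is none. *)
pose d n := xget (0 : H) [set x | S x /\ f x = n].
exists d => x e e0.
have e0' : 0 < e%:C%C :> R[i] by rewrite ltcR.
have [y [By Sy]] : ((ball x e%:C%C) `&` S) !=set0.
  apply: S_dense; first by exists x; exact: ballxx.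
  exact: ball_open.
exists (f y); have -> : d (f y) = y.
  rewrite /d; case: xgetP => [z _ [Sz fz]|/(_ y)[]//].
  by apply: f_inj => //; rewrite inE.
move: By; rewrite -ball_normE /ball_ /= rnormE ltcR.
by [].
Qed.

Section MeanKernel.
Context (R : realType) (H : infHilbertType R) (d : nat -> H).
Local Notation P n := (gs_op d n).

(** Otherwise the first [n] Gram-Schmidt vectors would span [H]. *)
Lemma exists_not_gs_op_fixed n : exists x, P n x <> x.
Proof.
apply/existsNP => fixP; apply: (@infinite_dimensional R H).
exists n, (fun i => gs_vec d i) => x; exists (fun i => hdot x (gs_vec d i)).
by rewrite -[LHS]fixP; exact: gs_projE.
Qed.

(** All the averaged projections lie below [P m] for the largest index [m], so they kill
    [x - P m x]. *)
Lemma mean_gs_op_kernel s : exists2 w, w != 0 & mean_gs_op d s w = 0.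
Proof.
pose m := (\max_(k <- s) k)%N; have [x xP] := exists_not_gs_op_fixed m.
exists (x - P m x); first by rewrite subr_eq0; apply/eqP => /esym.
rewrite mean_gs_opE big_seq big1 ?scaler0// => k ks.
by rewrite boundedOpB gs_opK ?subrr// (leq_bigmax_seq k).
Qed.

Lemma mean_gs_op_fixed n v s : P n v = v -> s != [::] -> all (leq n) s ->
  mean_gs_op d s v = v.
Proof.
move=> nv s0 /allP sn; rewrite mean_gs_opE.
rewrite big_seq (eq_bigr (fun=> v)) => [|k ks]; last first.
  by rewrite -nv gs_opKr ?sn.
rewrite -big_seq big_const_seq count_predT iter_addr_0 -(scaler_nat _ v) scalerA.
rewrite -(rmorph_nat (real_complex R)) -rmorphM/= mulVf ?rmorph1 ?scale1r//.
by rewrite pnatr_eq0 size_eq0.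
Qed.

End MeanKernel.

(** * The filter of almost central means *)

Section CentralFilter.
Context (R : realType) (H : infHilbertType R) (d : nat -> H).
Hypothesis d_dense : forall x (e : R), 0 < e -> exists n, rnorm (x - d n) < e.

(** An enumeration of all finite sequences; a number that codes none yields the empty one. *)
Definition mean_gs_seq n : seq nat := odflt [::] (unpickle n).

(** [M] bounds the indices from below and also sets the precision, so intersections are handled by
    concatenating the lists and taking the maximum. *)
Definition almost_central (F : seq (boundedOp H)) M : set nat :=
  [set n | [/\ mean_gs_seq n != [::], all (leq M) (mean_gs_seq n) &
    forall a, a \in F -> anorm (mean_gs_op d (mean_gs_seq n) * a -
      a * mean_gs_op d (mean_gs_seq n)) <= M.+1%:R^-1]].

Definition central_filter : set_system nat :=
  [set X | exists F M, almost_central F M `<=` X].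

Lemma central_filter_proper : ProperFilter central_filter.
Proof.
split=> [[F [M F0]]|].
  have M0 : 0 < M.+1%:R^-1 :> R by rewrite invr_gt0.
  have [s [s0 sM sF]] := exists_mean_commutator d_dense F M M0.
  have sE : mean_gs_seq (pickle s) = s by rewrite /mean_gs_seq pickleK.
  by apply: (F0 (pickle s)); split; rewrite sE.
split.
- by exists [::], 0%N.
- move=> X Y [F [M FX]] [G [N GY]]; exists (F ++ G), (maxn M N) => n [n0 nMN nFG].
  have mono K a : (K <= maxn M N)%N -> a \in F ++ G ->
      anorm (mean_gs_op d (mean_gs_seq n) * a -
        a * mean_gs_op d (mean_gs_seq n)) <= K.+1%:R^-1.
    move=> KMN aFG; rewrite (le_trans (nFG a aFG))// lef_pV2 ?posrE//.
    by rewrite ler_nat.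
  split; [apply: FX|apply: GY]; split=> //.
  + by apply: sub_all nMN => k; apply: leq_trans; rewrite leq_maxl.
  + by move=> a aF; rewrite mono ?leq_maxl// mem_cat aF.
  + by apply: sub_all nMN => k; apply: leq_trans; rewrite leq_maxr.
  + by move=> a aG; rewrite mono ?leq_maxr// mem_cat aG orbT.
- by move=> X Y XY [F [M FX]]; exists F, M; exact: subset_trans XY.
Qed.

Lemma central_filter_almost_central F M : central_filter (almost_central F M).
Proof. by exists F, M. Qed.

Lemma mean_gs_bounded :
  (fun n => mean_gs_op d (mean_gs_seq n)) \in @bounded_seq R (boundedOp H).
Proof. by apply/bounded_seqP; exists 1 => n; exact: anorm_mean_gs_op. Qed.

Definition mean_gs_linfty : linfty (boundedOp H) := Linfty mean_gs_bounded.

(** * The class of the means in the ultrapower *)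

Section Ultra.
Variable V : pfilter_on nat.
Hypothesis centralV : central_filter `<=` (V : set_system nat).

Let V_central F M : (V : set_system nat) (almost_central F M).
Proof. exact/centralV/central_filter_almost_central. Qed.

Lemma central_filter_nonprincipal n : (V : set_system nat) <> principal_filter n.
Proof.
move=> VE; have centralVn M : almost_central [::] M n.
  by apply/principal_filterP; rewrite -VE.
(* The first term of the sequence coded by [n] would have to exceed itself. *)
have [] := centralVn (head 0%N (mean_gs_seq n)).+1.
by case: (mean_gs_seq n) => //= k s _; rewrite ltnn.
Qed.

Definition mean_gs_ultra : ultrapower V (boundedOp H) := quot_pi _ mean_gs_linfty.

Lemma mean_gs_ultra_commutant :
  mean_gs_ultra \in commutant_pred (range (@diag R V (boundedOp H))).
Proof.
apply/commutant_predP => _ [a _ <-].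
rewrite /diag /mean_gs_ultra.
rewrite /GRing.mul/= -!quot_piM; apply/quot_piP/c_idealP.
apply/cvgr0Pnorm_le => e e0.
have [M Me] : exists M : nat, M.+1%:R^-1 <= e.
  exists (Num.truncn e^-1); rewrite invf_ple ?posrE//.
  by rewrite ltW// truncnS_gt.
apply: filterS (V_central [:: a] M) => n [_ _ /(_ a)].
rewrite inE eqxx => /(_ isT) h.
rewrite ger0_norm ?anorm_ge0// (le_trans _ Me)// (le_trans _ h)//.
by rewrite -anormN opprB.
Qed.

(** A nonzero vector fixed by means close to [c] forces [c = 1]; a kernel vector of a mean then
    keeps it at distance at least [1] from the identity. *)
Lemma mean_gs_ultra_nonscalar (c : R[i]) : mean_gs_ultra <> c *: 1.
Proof.
rewrite /mean_gs_ultra /GRing.scale/= -quot_piZ => /quot_piP/c_idealP.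
move=> /cvgr0Pnorm_le dist0.
(* As [P 0 = 0], a vector that it does not fix is nonzero. *)
have [y y0] := exists_not_gs_op_fixed d 0.
have {}y0 : y != 0 by apply/eqP => yE; apply: y0; rewrite yE boundedOp0.
have ry0 : 0 < rnorm y by rewrite lt0r rnorm_eq0 y0 rnorm_ge0.
(* Take [v = P m y] with [y] moved by at most half of its norm. *)
have [m [v v0 mv]] : exists m, exists2 v, v != 0 & gs_op d m v = v.
  have [m ym] := filter_ex (gs_op_cvg d_dense y (divr_gt0 ry0 (ltr0Sn R 1))).
  exists m, (gs_op d m y); last by rewrite gs_opK.
  apply/eqP => my; move: ym; rewrite my subr0; lra.
have rv0 : 0 < rnorm v by rewrite lt0r rnorm_eq0 v0 rnorm_ge0.
have near_c e : 0 < e -> exists n, [/\ mean_gs_op d (mean_gs_seq n) v = v &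
    forall x, rnorm (mean_gs_op d (mean_gs_seq n) x - c *: x) <= e * rnorm x].
  move=> e0; have [n [[n0 nm _] ne]] :=
    filter_ex (filterI (V_central [::] m) (dist0 e e0)).
  exists n; split; first exact: mean_gs_op_fixed nm.
  move=> x; move: ne; rewrite ger0_norm ?anorm_ge0// => ne.
  apply: le_trans (ler_wpM2r (rnorm_ge0 x) ne).
  exact: (anorm_bound (mean_gs_op d (mean_gs_seq n) - c *: 1) x).
have c1 : c = 1.
  apply/esym/eqP; rewrite -subr_eq0 -rnorm_eq0 eq_le rnorm_ge0 andbT.
  apply/ler_addgt0Pr => e e0; have [n [nv /(_ v)]] := near_c e e0.
  by rewrite nv -[X in X - _]scale1r -scalerBl rnormZ ler_pM2r ?add0r.
have half0 : 0 < 2^-1 :> R by rewrite invr_gt0.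
have [n [_ ne]] := near_c _ half0.
have [w w0 nw] := mean_gs_op_kernel d (mean_gs_seq n).
have rw0 : 0 < rnorm w by rewrite lt0r rnorm_eq0 w0 rnorm_ge0.
by move: (ne w); rewrite nw c1 scale1r sub0r rnormN; lra.
Qed.

End Ultra.
End CentralFilter.

(** * A nonscalar element of the quotient by the annihilator *)

Theorem theorem1 (R : realType) (H : infHilbertType R) (sepH : separable_space H) :
  exists V : pfilter_on nat,
    [/\ UltraFilter V,
        forall n : nat, (V : set_system nat) <> principal_filter n &
        [set: F_alg V (boundedOp H)] <> [set c *: 1 | c in [set: R[i]]]].
Proof.
have [d d_dense] := separable_dense_seq sepH.
have [U [ultraU centralU]] := ultraFilterLemma (central_filter_proper d_dense).
pose V := PFilterPack U (@ultra_proper _ _ ultraU).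
exists V; split=> //; first exact: (@central_filter_nonprincipal R H d V).
move=> all_scalar.
pose b : central_seq V (boundedOp H) :=
  Commutant (@mean_gs_ultra_commutant R H d V centralU).
have : [set: F_alg V (boundedOp H)] (quot_pi _ b) by [].
rewrite all_scalar => -[c _].
rewrite /GRing.scale/= -quot_piZ => /quot_piP.
(* The annihilator is zero, so a scalar class comes from a scalar in the ultrapower. *)
rewrite annihilator_eq0 subr_eq0 => /eqP/(congr1 val) cb.
exact: (@mean_gs_ultra_nonscalar R H d d_dense V centralU c) (esym cb).
Qed.
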